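(* For every $k\ge2$, the $k$-way indicator aggregation portfolio strategy $\mathrm{IA}[k]$ is universalizable.
   Context: Market with $m\ge2$ assets and return vectors $\mathbf x_t\in(0,\infty)^m$, $t\ge0$. On each day $t$, each stock $i$ has indicators $\mathbf v_{ti}=(v_{ti1},\dots,v_{tik})\in(0,1]^k$, normalized so that for every $t$ and $j$ there is some $i$ with $v_{tij}=1$. $\mathrm{IA}[k]$ has parameter space $\mathcal W_k=\{\mathbf w\in[0,1]^k:\sum_j w_j=1\}$ and description $\mathrm{IA}_t(\mathbf w)=\Big(\frac{\mathbf w\cdot\mathbf v_{t1}}{\sum_{l=1}^m\mathbf w\cdot\mathbf v_{tl}},\dots,\frac{\mathbf w\cdot\mathbf v_{tm}}{\sum_{l=1}^m\mathbf w\cdot\mathbf v_{tl}}\Big)$. General notions: for a strategy $S$ with parameter space $\mathbb W$ and descriptions $S_t(\mathbf w)\in\mathcal W_m$, $\mathcal R_n(S(\mathbf w))=\prod_{t=0}^{n-1}S_t(\mathbf w)\cdot\mathbf x_t$ ($\mathcal R_0\equiv1$), $\mathcal L_n=\frac1n\log\mathcal R_n$, similarly for parameter-free strategies. $\mu$ is the uniform probability measure on $\mathbb W$ and $\mathcal U(S)$ has $\mathcal U_t(S)=\int_{\mathbb W}S_t\mathcal R_t\,d\mu/\int_{\mathbb W}\mathcal R_t\,d\mu$. $U$ is a universalization of $S$ if there is $\eta_n\to0$, independent of market data, with $\mathcal L_n(U)\ge\sup_{\mathbf w}\mathcal L_n(S(\mathbf w))-\eta_n$ for all $n$ and all market data.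 The $\varepsilon$-modification is $\bar S_t(\mathbf w)=(1-\frac{\varepsilon}{2(t+1)^2})S_t(\mathbf w)+\frac{\varepsilon}{2m(t+1)^2}(1,\dots,1)$; $S$ is universalizable if for every $\varepsilon\in(0,1)$, $\mathcal U(\bar S)$ is a universalization of $S$. *)

(* Defs.v *)
From HB Require Import structures.
From mathcomp Require Import all_boot all_order all_algebra.
From mathcomp Require Import all_classical all_reals all_analysis.
Set Implicit Arguments. Unset Strict Implicit. Unset Printing Implicit Defensive.
Import Order.TTheory GRing.Theory Num.Theory.
Local Open Scope classical_set_scope.
Local Open Scope ring_scope.

Section Portfolio.
Variable R : realType.

Definition dotv (m : nat) (a b : 'I_m -> R) : R := \sum_(i < m) a i * b i.

Definition in_simplex (k : nat) (w : 'I_k -> R) : Prop :=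
  (forall j, 0 <= w j <= 1) /\ \sum_(j < k) w j = 1.

Fixpoint cube_int (j : nat) (g : seq R -> R) : R :=
  match j with
  | 0%N => g [::]
  | j'.+1 => Rintegral (@lebesgue_measure R) `[0%R, 1%R]
               (fun s => cube_int j' (fun l => g (s :: l)))
  end.

Definition simplex_point (k : nat) (s : seq R) : 'I_k -> R :=
  fun i => if (i < k.-1)%N then nth 0 s i else 1 - \sum_(x <- s) x.

(** Integral against the uniform probability measure mu on W_k: W_k is
    parametrized by its first k-1 coordinates, ranging over the region
    {s in [0,1]^(k-1) : sum s <= 1} of Lebesgue volume 1/(k-1)!. *)
Definition simplex_int (k : nat) (f : ('I_k -> R) -> R) : R :=
  (k.-1)`!%:R * cube_int k.-1
    (fun s => if \sum_(x <- s) x <= 1 then f (@simplex_point k s) else 0).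

Definition wealth (m : nat) (P : nat -> 'I_m -> R) (x : nat -> 'I_m -> R)
  (n : nat) : R := \prod_(t < n) dotv (P t) (x t).

Definition logret (m : nat) (P : nat -> 'I_m -> R) (x : nat -> 'I_m -> R)
  (n : nat) : R := n%:R^-1 * ln (wealth P x n).

(** A strategy with parameter space W_k: [S t w] is S_t(w).
    S(w) as a parameter-free strategy is [fun t => S t w]. *)
Definition param_strategy (m k : nat) := nat -> ('I_k -> R) -> 'I_m -> R.

Definition univ_portfolio (m k : nat) (S : param_strategy m k)
  (x : nat -> 'I_m -> R) : nat -> 'I_m -> R :=
  fun t i =>
    @simplex_int k (fun w => S t w i * wealth (fun s => S s w) x t) /
    @simplex_int k (fun w => wealth (fun s => S s w) x t).

Definition eps_mod (m k : nat) (S : param_strategy m k) (eps : R)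
  : param_strategy m k :=
  fun t w i => (1 - eps / (2 * (t%:R + 1) ^+ 2)) * S t w i
               + eps / (2 * m%:R * (t%:R + 1) ^+ 2).

(** Market data of type [D], with validity predicate [valid] and return
    vectors [ret d].  Strategies may depend on the market data. *)
Definition is_universalization (D : Type) (m k : nat) (valid : D -> Prop)
  (ret : D -> nat -> 'I_m -> R) (S : D -> param_strategy m k)
  (U : D -> nat -> 'I_m -> R) : Prop :=
  exists eta : nat -> R, eta @ \oo --> 0 /\
    forall d, valid d -> forall n, (0 < n)%N ->
      forall w, in_simplex w ->
        logret (fun t => S d t w) (ret d) n - eta n <= logret (U d) (ret d) n.

Definition universalizable (D : Type) (m k : nat) (valid : D -> Prop)
  (ret : D -> nat -> 'I_m -> R) (S : D -> param_strategy m k) : Prop :=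
  forall eps : R, 0 < eps < 1 ->
    is_universalization valid ret S
      (fun d => univ_portfolio (eps_mod (S d) eps) (ret d)).

(** Market data for IA[k]: returns x_t in (0,oo)^m and indicators
    v_{ti} in (0,1]^k, normalized. *)
Definition IA_data (m k : nat) : Type :=
  ((nat -> 'I_m -> R) * (nat -> 'I_m -> 'I_k -> R))%type.

Definition IA_valid (m k : nat) (d : IA_data m k) : Prop :=
  (forall t i, 0 < d.1 t i) /\
  (forall t i j, 0 < d.2 t i j <= 1) /\
  (forall t j, exists i, d.2 t i j = 1).

Definition IA (m k : nat) (v : nat -> 'I_m -> 'I_k -> R) : param_strategy m k :=
  fun t w i => dotv w (v t i) / \sum_(l < m) dotv w (v t l).

End Portfolio.

(* Main.v *)
Require Import Defs.
From HB Require Import structures.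
From mathcomp Require Import all_boot all_order all_algebra.
From mathcomp Require Import all_classical all_reals all_analysis.
From mathcomp Require Import measurable_realfun ring lra.
Import Order.TTheory GRing.Theory Num.Theory.
Set Implicit Arguments.
Unset Strict Implicit.
Unset Printing Implicit Defensive.
Local Open Scope classical_set_scope.
Local Open Scope ring_scope.

(** The wealth of the universal portfolio telescopes to the average, over the
    simplex, of the wealths of the modified strategies, up to the total mass of
    the integral.  The average is bounded below near a given [w]: if
    [w' >= (1 - alpha) w] coordinatewise, then each weight [IA_t(w')_i] is at
    least [(1 - alpha) / (1 + alpha m)] times [IA_t(w)_i], because the
    normalization of the indicators makes the denominator of [IA_t(w)] at least
    1.  The set of such [w'] contains a cube of side [alpha / k] in the first
    [k - 1] coordinates.  With [alpha = 1 / (n + 1)], and since the [eps]-modification costs at most a factor [n + 1] over [n]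
    days, only a factor polynomial in [n] is lost, so the regret per day is
    [O(log n / n)]; the cruder [O(1 / sqrt n)] is what is proved. *)

(** Inversion and [powR] with exponent -1 both send 0 to 0, so they agree on the nonnegative
    half-line; oddness covers the rest. This serves the denominators of [IA]. *)
Lemma measurable_invr (R : realType) :
  measurable_fun [set: R] (fun x : R => x^-1).
Proof.
rewrite (_ : (fun x : R => x^-1) = (fun x : R =>
  if 0 <= x then x `^ (-1) else - ((- x) `^ (-1)))); last first.
  apply/funext => x; case: ifPn => x0; first by rewrite powR_inv1.
  by rewrite powR_inv1 ?invrN ?opprK// oppr_ge0 ltW// ltNge.
apply: measurable_fun_ifT.
- by apply: measurable_fun_ler.
- exact: measurable_powR.
- apply: measurableT_comp => //.
  by apply: (measurableT_comp (measurable_powR (-1 : R))).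
Qed.

(** * Iterated Lebesgue integrals over the unit cube *)

Section cube_integral.
Context {R : realType}.
Notation mu := (@lebesgue_measure R).
Implicit Types (g : seq R -> R) (l : seq R).

Definition in_cube (j : nat) l := (size l == j) && all (fun x => 0 <= x <= 1) l.

Lemma in_cube_cons j s l :
  in_cube j.+1 (s :: l) = (0 <= s <= 1) && in_cube j l.
Proof. by rewrite /in_cube /= eqSS andbCA. Qed.

Lemma eq_cube_int j g1 g2 : (forall l, in_cube j l -> g1 l = g2 l) ->
  cube_int j g1 = cube_int j g2.
Proof.
elim: j g1 g2 => [|j IH] g1 g2 g12 /=; first exact: g12.
apply: eq_Rintegral => s; rewrite inE/= in_itv/= => s01.
by apply: IH => l lj; apply: g12; rewrite in_cube_cons s01.
Qed.

(* Borel measurability in the first [j] entries, stated through test maps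
   because [seq R] carries no sigma-algebra. *)
Definition borel_seq (j : nat) g := forall d (T : measurableType d)
  (u : T -> seq R), (forall t, size (u t) = j) ->
  (forall i, measurable_fun [set: T] (fun t => nth 0 (u t) i)) ->
  measurable_fun [set: T] (fun t => g (u t)).

Lemma borel_seq_cons j g s : borel_seq j.+1 g ->
  borel_seq j (fun l => g (s :: l)).
Proof.
move=> mg d T u uj mnth; apply: (mg d T (fun t => s :: u t)) => [t|[|i]] //=.
by rewrite uj.
Qed.

(** Linearity of an iterated integral needs integrability at every level of nesting, hence the
    recursion over all sections. *)
Fixpoint cube_integrable (j : nat) g : Prop :=
  match j with
  | 0%N => True
  | j'.+1 =>
    mu.-integrable `[0, 1] (EFin \o fun s => cube_int j' (fun l => g (s :: l)))
    /\ forall s, 0 <= s <= 1 -> cube_integrable j' (fun l => g (s :: l))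
  end.

Lemma mu01 : mu `[0, 1] = 1%E.
Proof. by rewrite lebesgue_measure_itv/= lte_fin ltr01 oppr0 adde0. Qed.

Lemma bounded_integrable01 (f : R -> R) B : measurable_fun setT f ->
  (forall s, 0 <= f s <= B) -> mu.-integrable `[0, 1] (EFin \o f).
Proof.
move=> mf fB; apply: measurable_bounded_integrable => //.
- by have := @ltry R 1; rewrite -mu01.
- exact: measurable_funS mf.
- exists B; split; first by rewrite num_real.
  move=> M BM s _ /=; have /andP[f0 fs] := fB s.
  by rewrite ger0_norm// (le_trans fs)// ltW.
Qed.

Lemma Rintegral01_bounds (f : R -> R) B : measurable_fun setT f ->
  (forall s, 0 <= f s <= B) -> 0 <= Rintegral mu `[0, 1] f <= B.
Proof.
move=> mf fB; apply/andP; split.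
  by apply: Rintegral_ge0 => s _; have /andP[] := fB s.
have B0 : 0 <= B by have /andP[/le_trans] := fB 0; apply.
have -> : B = Rintegral mu `[0, 1] (fun=> B).
  transitivity (B * fine (mu `[0, 1])); first by rewrite mu01 mulr1.
  by apply/esym/Rintegral_cst.
apply: le_Rintegral => //.
- exact: bounded_integrable01 fB.
- by apply: (@bounded_integrable01 _ B) => // s; rewrite B0 lexx.
- by move=> s _; have /andP[] := fB s.
Qed.

Lemma measurable_Rintegral01 d (T : measurableType d) (f : T * R -> R) :
  measurable_fun setT f -> (forall z, 0 <= f z) ->
  measurable_fun [set: T] (fun t => Rintegral mu `[0, 1] (fun s => f (t, s))).
Proof.
move=> mf f0.
(* Extension by zero turns the integral over [[0, 1]] into one over the whole line, where Tonelli's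
   theorem gives measurability in the parameter. *)
pose h : T * R -> R := fun z => if 0 <= z.2 <= 1 then f z else 0.
have mh : measurable_fun setT h.
  apply: measurable_fun_ifT => //; apply: measurable_and;
  by apply: measurable_fun_ler.
rewrite (_ : (fun t => _) = fine \o fubini_F mu (EFin \o h)).
  apply: measurableT_comp => //.
  apply: measurable_fun_fubini_tonelli_F; first exact/measurable_EFinP.
  by move=> z; rewrite /= lee_fin /h; case: ifP.
apply/funext => t; rewrite /= /fubini_F /Rintegral integral_mkcond.
congr fine; apply: eq_integral => s _.
by rewrite /patch /h /= mem_setE in_itv/=; case: ifP.
Qed.

Lemma measurable_nth_rcons d (T : measurableType d) n (u : T -> seq R)
    (s : T -> R) (i : nat) : (forall t, size (u t) = n) ->
  (forall i, measurable_fun [set: T] (fun t => nth 0 (u t) i)) ->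
  measurable_fun [set: T] s ->
  measurable_fun [set: T] (fun t => nth 0 (rcons (u t) (s t)) i).
Proof.
move=> un mnth ms; rewrite [X in measurable_fun _ X](_ : _ = fun t =>
    if (i < n)%N then nth 0 (u t) i else if i == n then s t else 0).
  by case: (i < n)%N => //; case: (i == n).
by apply/funext => t; rewrite nth_rcons un.
Qed.

(** Measurability and bounds share one induction: bounding an outer integral needs measurable
    sections, and Tonelli needs nonnegative ones. The prefix [u t] holds the entries not integrated;
    each step appends one integrated variable to it. *)
Lemma cube_int_borel n j g B : borel_seq (n + j) g ->
  (forall l, 0 <= g l <= B) ->
  forall d (T : measurableType d) (u : T -> seq R),
    (forall t, size (u t) = n) ->
    (forall i, measurable_fun [set: T] (fun t => nth 0 (u t) i)) ->
  measurable_fun [set: T] (fun t => cube_int j (fun l => g (u t ++ l))) /\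
  forall t, 0 <= cube_int j (fun l => g (u t ++ l)) <= B.
Proof.
elim: j n g => [|j IH] n g mg gB d T u un mnth.
  split=> [|t]; last exact: gB.
  apply: (mg d T (fun t => u t ++ [::])) => [t|i].
    by rewrite cats0 addn0.
  by rewrite [X in measurable_fun _ X](_ : _ = fun t => nth 0 (u t) i)//; apply/funext => t; rewrite cats0.
have mg' : borel_seq (n.+1 + j) g by rewrite addSnnS.
have rconsE v s : (fun l => g (v ++ s :: l)) = (fun l => g (rcons v s ++ l)).
  by apply/funext => l; rewrite cat_rcons.
have msec t :
    measurable_fun setT (fun s => cube_int j (fun l => g (u t ++ s :: l))) /\
    forall s, 0 <= cube_int j (fun l => g (u t ++ s :: l)) <= B.
  rewrite [X in measurable_fun _ X](_ : _ = fun s =>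
    cube_int j (fun l => g (rcons (u t) s ++ l))); last first.
    by apply/funext => s; rewrite rconsE.
  have [|i|ms bs] := IH _ _ mg' gB _ _ (fun s : R => rcons (u t) s).
  - by move=> s; rewrite size_rcons un.
  - by apply: (measurable_nth_rcons (n := n)) => // i'; exact: measurable_cst.
  - by split=> // s; rewrite rconsE.
split=> [/=|t]; last by apply: Rintegral01_bounds; have [] := msec t.
apply: (measurable_Rintegral01
  (f := fun z : T * R => cube_int j (fun l => g (u z.1 ++ z.2 :: l)))).
  rewrite [X in measurable_fun _ X](_ : _ = fun z =>
    cube_int j (fun l => g (rcons (u z.1) z.2 ++ l))); last first.
    by apply/funext => z; rewrite rconsE.
  (* The induction hypothesis, used above with [t] fixed, is now tested on the product space to get
     joint measurability. *)
  have [||//] := IH _ _ mg' gB _ _ (fun z : T * R => rcons (u z.1) z.2).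
  - by move=> z; rewrite size_rcons un.
  - move=> i; apply: (measurable_nth_rcons (n := n)) => // i'.
    exact: (measurableT_comp (mnth i')).
by move=> [t s] /=; have /andP[] := (msec t).2 s.
Qed.

Lemma cube_int_bounds j g B : borel_seq j g -> (forall l, 0 <= g l <= B) ->
  0 <= cube_int j g <= B.
Proof.
move=> mg gB.
(* An empty prefix over a one-point space removes the parameter. *)
have [//|i|_] := @cube_int_borel 0 j g B mg gB _ unit (fun=> [::]).
  exact: measurable_cst.
by apply; exact: tt.
Qed.

Lemma borel_cube_integrable j g B : borel_seq j g ->
  (forall l, 0 <= g l <= B) -> cube_integrable j g.
Proof.
elim: j g => [//|j IH] g mg gB /=; split=> [|s _].
  have [//|i|ms bs] := @cube_int_borel 1 j g B mg gB _ R (fun s => [:: s]).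
    case: i => [|i]; first exact: measurable_id.
    rewrite [X in measurable_fun _ X](_ : _ = fun=> 0) //.
    by apply/funext => s; case: i.
  exact: bounded_integrable01 ms bs.
by apply: IH => //; exact: borel_seq_cons.
Qed.

Lemma cube_int_cst0 j : cube_int j (fun=> 0) = 0 :> R.
Proof.
by elim: j => [//|j IH] /=; under eq_Rintegral do rewrite IH;
  rewrite Rintegral_cst// mul0r.
Qed.

Lemma cube_integrable_cst0 j : cube_integrable j (fun=> 0).
Proof.
elim: j => [//|j IH] /=; split=> //; rewrite cube_int_cst0.
by apply: (@bounded_integrable01 _ 0) => // s; rewrite lexx.
Qed.

Lemma cube_int_linear j (a : R) f g :
  cube_integrable j f -> cube_integrable j g ->
  cube_integrable j (fun l => a * f l + g l) /\
  cube_int j (fun l => a * f l + g l) = a * cube_int j f + cube_int j g.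
Proof.
elim: j f g => [//|j IH] f g /= [intf hf] [intg hg].
have E s : 0 <= s <= 1 ->
    cube_int j (fun l => a * f (s :: l) + g (s :: l)) =
    a * cube_int j (fun l => f (s :: l)) + cube_int j (fun l => g (s :: l)).
  by move=> s01; have [] := IH _ _ (hf s s01) (hg s s01).
have intaf : mu.-integrable `[0, 1]
    (EFin \o fun s => a * cube_int j (fun l => f (s :: l))).
  by apply: (eq_integrable _ _ _ _ (integrableZl _ a intf)).
split; first split.
- apply: (eq_integrable _ _ _ _ (integrableD _ intaf intg)) => //.
  by move=> s; rewrite inE/= in_itv/= => s01; rewrite E.
- by move=> s s01; have [] := IH _ _ (hf s s01) (hg s s01).
- rewrite -RintegralZl// -RintegralD//.
  by apply: eq_Rintegral => s; rewrite inE/= in_itv/= => s01; rewrite E.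
Qed.

Lemma cube_int_sum j (I : Type) (r : seq I) (c : I -> R) (f : I -> seq R -> R) :
  (forall i, cube_integrable j (f i)) ->
  cube_int j (fun l => \sum_(i <- r) c i * f i l) =
  \sum_(i <- r) c i * cube_int j (f i).
Proof.
move=> intf.
suff [] : cube_integrable j (fun l => \sum_(i <- r) c i * f i l) /\
  cube_int j (fun l => \sum_(i <- r) c i * f i l) =
  \sum_(i <- r) c i * cube_int j (f i) by [].
elim: r => [|i r [IH1 IH2]].
  under eq_fun do rewrite big_nil; rewrite big_nil cube_int_cst0.
  by split=> //; exact: cube_integrable_cst0.
under eq_fun do rewrite big_cons; rewrite big_cons -IH2.
exact: cube_int_linear.
Qed.

Lemma cube_int_ge0 j g : (forall l, 0 <= g l) -> 0 <= cube_int j g.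
Proof.
elim: j g => [|j IH] g g0 /=; first exact: g0.
by apply: Rintegral_ge0 => s _; exact: IH.
Qed.

(** Restricting the variables one after another to intervals of length [delta] discards only
    nonnegative contributions, and each interval yields one factor [delta]. *)
Lemma cube_int_ge_box j (a : seq R) (delta c : R) g :
  size a = j -> 0 <= delta -> 0 <= c ->
  (forall x, x \in a -> 0 <= x /\ x + delta <= 1) ->
  cube_integrable j g -> (forall l, 0 <= g l) ->
  (forall l, size l = j ->
    (forall i, (i < j)%N -> nth 0 a i <= nth 0 l i <= nth 0 a i + delta) ->
    c <= g l) ->
  c * delta ^+ j <= cube_int j g.
Proof.
move=> + d0 c0; elim: j a g => [|j IH] a g.
  by move=> _ _ _ _ cg; rewrite expr0 mulr1; apply: cg.
case: a => [//|a0 a] /= [aj] ha [intg hg] g0 cg.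
have [a00 a01] : 0 <= a0 /\ a0 + delta <= 1 by apply: ha; rewrite mem_head.
have sub s : a0 <= s <= a0 + delta -> 0 <= s <= 1 by lra.
set h := fun s => cube_int j (fun l => g (s :: l)).
have h0 s : 0 <= h s by exact: cube_int_ge0.
have step : c * delta ^+ j.+1 = Rintegral mu `[a0, a0 + delta]
    (fun=> c * delta ^+ j).
  transitivity (c * delta ^+ j * fine (mu `[a0, a0 + delta])); last first.
    by apply/esym/Rintegral_cst.
  rewrite exprSr mulrA; congr (_ * _).
  (* The length formula tests [a0 < a0 + delta]; where the test fails, [delta = 0]. *)
  rewrite lebesgue_measure_itv/= lte_fin; case: ifPn => [_|].
    by rewrite /= addrAC subrr add0r.
  by rewrite -leNgt gerDl => d0'; apply/eqP; rewrite eq_le d0 d0'.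
have sub01 : `[a0, a0 + delta] `<=` `[0%R, 1%R].
  by move=> s /=; rewrite !in_itv/=; exact: sub.
have inth : mu.-integrable `[a0, a0 + delta] (EFin \o h).
  exact: integrableS intg.
rewrite step; apply: (@le_trans _ _ (Rintegral mu `[a0, a0 + delta] h)).
  apply: le_Rintegral => //.
    apply: (@integrableS _ _ _ mu `[0, 1]) => //.
    apply: (@bounded_integrable01 _ (c * delta ^+ j)) => // s.
    by rewrite lexx mulr_ge0// exprn_ge0.
  move=> s; rewrite /= in_itv/= => sa; rewrite /h.
  apply: (IH a) => // [x xa||l lj hl].
  - by apply: ha; rewrite inE xa orbT.
  - exact/hg/sub.
  - by apply: cg => /= [|[|i] ij]; rewrite ?lj//; exact: hl.
rewrite /Rintegral fine_le//.
- exact: integrable_fin_num.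
- exact: integrable_fin_num.
- apply: ge0_subset_integral => //.
  + by have [] := integrableP _ _ _ intg.
  + by move=> s _; rewrite /= lee_fin.
Qed.

End cube_integral.

(** * Integration over the simplex through its first coordinates *)

Lemma measurable_all d (T : measurableType d) (I : Type) (s : seq I)
    (h : I -> T -> bool) : (forall i, measurable_fun [set: T] (h i)) ->
  measurable_fun [set: T] (fun t => all (fun i => h i t) s).
Proof.
move=> mh; elim: s => [|i s IH] /=; first exact: measurable_cst.
exact: measurable_and.
Qed.

Section simplex_integral.
Context {R : realType}.

(** The analogue of [borel_seq] for functions of a weight vector. *)
Definition borel_fun (k : nat) (f : ('I_k -> R) -> R) :=
  forall d (T : measurableType d) (w : T -> 'I_k -> R),
  (forall i, measurable_fun [set: T] (fun t => w t i)) ->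
  measurable_fun [set: T] (fun t => f (w t)).

Definition simplex_bounded (k : nat) (f : ('I_k -> R) -> R) (B : R) :=
  forall w, in_simplex w -> 0 <= f w <= B.

(** The test [in_cube] leaves the integral unchanged, but makes bounds known only on the simplex
    hold for every list, as the lemmas on [cube_int] require. *)
Definition simplex_ext (k : nat) (f : ('I_k -> R) -> R) (l : seq R) : R :=
  if in_cube k.-1 l && (\sum_(x <- l) x <= 1) then f (simplex_point l) else 0.

Lemma simplex_int_ext k (f : ('I_k -> R) -> R) :
  simplex_int f = k.-1`!%:R * cube_int k.-1 (simplex_ext f).
Proof.
rewrite /simplex_int; congr (_ * _); apply: eq_cube_int => l lk.
by rewrite /simplex_ext lk.
Qed.

Lemma sum_seq_nth (l : seq R) n : size l = n ->
  \sum_(x <- l) x = \sum_(i < n) nth 0 l i.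
Proof. by move=> <-; rewrite (big_nth 0) big_mkord. Qed.

Lemma simplex_point_in_simplex k (l : seq R) :
  in_cube k l -> \sum_(x <- l) x <= 1 -> in_simplex (@simplex_point R k.+1 l).
Proof.
case/andP => /eqP lk /allP l01 l1.
have nth01 i : (i < k)%N -> 0 <= nth 0 l i <= 1.
  by move=> ik; apply: l01; rewrite mem_nth// lk.
have l0 : 0 <= \sum_(x <- l) x.
  by rewrite big_seq; apply: sumr_ge0 => x /l01 /andP[].
split=> [j|].
  by rewrite /simplex_point /=; case: ifP => [/nth01//|_]; lra.
rewrite big_ord_recr/= /simplex_point /= ltnn (sum_seq_nth lk).
under eq_bigr do rewrite ltn_ord.
by rewrite addrC subrK.
Qed.

Lemma borel_simplex_ext k (f : ('I_k -> R) -> R) :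
  borel_fun f -> borel_seq k.-1 (simplex_ext f).
Proof.
move=> mf d T u uk mnth.
have msum : measurable_fun [set: T] (fun t => \sum_(x <- u t) x).
  rewrite [X in measurable_fun _ X](_ : _ = fun t =>
    \sum_(i < k.-1) nth 0 (u t) i); first exact: measurable_sum.
  by apply/funext => t; rewrite (sum_seq_nth (uk t)).
have mall : measurable_fun [set: T]
    (fun t => all (fun x => 0 <= x <= 1) (u t)).
  rewrite [X in measurable_fun _ X](_ : _ = fun t =>
    all (fun i => 0 <= nth 0 (u t) i <= 1) (iota 0 k.-1)).
    apply: measurable_all => i; apply: measurable_and;
    by apply: measurable_fun_ler.
  by apply/funext => t; rewrite -[in LHS](mkseq_nth 0 (u t)) uk all_map.
apply: measurable_fun_ifT => //.
- apply: measurable_and; last exact: measurable_fun_ler.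
  rewrite [X in measurable_fun _ X](_ : _ = fun t =>
    all (fun x => 0 <= x <= 1) (u t))//.
  by apply/funext => t; rewrite /in_cube uk eqxx.
- apply: mf => i; rewrite /simplex_point; case: (i < k.-1)%N => //.
  exact: measurable_funB.
Qed.

Lemma simplex_ext_bounds k (f : ('I_k.+1 -> R) -> R) B :
  0 <= B -> simplex_bounded f B -> forall l, 0 <= simplex_ext f l <= B.
Proof.
move=> B0 fB l; rewrite /simplex_ext; case: ifP => [/andP[lk l1]|_].
  exact/fB/simplex_point_in_simplex.
by rewrite lexx.
Qed.

Lemma simplex_int_sum k (I : Type) (r : seq I) (c : I -> R)
    (f : I -> ('I_k.+1 -> R) -> R) (B : R) : 0 <= B ->
  (forall i, borel_fun (f i)) -> (forall i, simplex_bounded (f i) B) ->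
  simplex_int (fun w => \sum_(i <- r) c i * f i w) =
  \sum_(i <- r) c i * simplex_int (f i).
Proof.
move=> B0 mf fB; rewrite simplex_int_ext.
rewrite (_ : simplex_ext _ = fun l => \sum_(i <- r) c i * simplex_ext (f i) l).
  rewrite cube_int_sum => [|i].
    rewrite mulr_sumr; apply: eq_bigr => i _.
    by rewrite simplex_int_ext mulrCA.
  by apply: borel_cube_integrable (simplex_ext_bounds B0 (fB i));
    exact: borel_simplex_ext.
apply/funext => l; rewrite /simplex_ext; case: ifP => // _.
by rewrite big1// => i _; rewrite mulr0.
Qed.

Lemma simplex_int_le k (f : ('I_k.+1 -> R) -> R) (B : R) : 0 <= B ->
  borel_fun f -> simplex_bounded f B -> simplex_int f <= k`!%:R * B.
Proof.
move=> B0 mf fB; rewrite simplex_int_ext ler_wpM2l//.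
by have /andP[] := cube_int_bounds (borel_simplex_ext mf)
  (simplex_ext_bounds B0 fB).
Qed.

(* The points [w'] below form the homothetic copy (1 - alpha) w + alpha W_k of
   the simplex, which contains a cube of side alpha / k. *)
Lemma simplex_int_ge k (f : ('I_k.+1 -> R) -> R) (B c alpha : R)
    (w : 'I_k.+1 -> R) :
  0 <= B -> borel_fun f -> simplex_bounded f B -> 0 <= c ->
  0 <= alpha <= 1 -> in_simplex w ->
  (forall w', in_simplex w' ->
    (forall j, (1 - alpha) * w j <= w' j) -> c <= f w') ->
  k`!%:R * (c * (alpha / k.+1%:R) ^+ k) <= simplex_int f.
Proof.
move=> B0 mf fB c0 /andP[a0 a1] [w01 w1] cf.
rewrite simplex_int_ext ler_wpM2l//=.
(* Dividing by [k.+1] keeps [k * delta <= alpha] and makes sense for [k = 0]. *)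
set delta := alpha / k.+1%:R.
have d0 : 0 <= delta by rewrite divr_ge0.
have da : k%:R * delta <= alpha.
  rewrite /delta mulrCA ler_piMr// ler_pdivrMr ?ltr0n// mul1r ler_nat.
  exact: leqnSn.
have da1 : delta <= alpha by rewrite ler_pdivrMr ?ltr0n// ler_peMr// ler1n.
have wa0 j : 0 <= (1 - alpha) * w j.
  by rewrite mulr_ge0 ?subr_ge0//; have /andP[] := w01 j.
have wa1 j : (1 - alpha) * w j + delta <= 1.
  have : (1 - alpha) * w j <= 1 - alpha.
    by rewrite ler_piMr ?subr_ge0//; have /andP[] := w01 j.
  lra.
pose a := mkseq (fun i => (1 - alpha) * w (inord i)) k.
apply: (cube_int_ge_box (a := a)) => //.
- exact: size_mkseq.
- by move=> x /mapP[i _ ->].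
- exact: borel_cube_integrable (borel_simplex_ext mf) (simplex_ext_bounds B0 fB).
- by move=> l; have /andP[] := simplex_ext_bounds B0 fB l.
move=> l lk hl.
have hnth i : (i < k)%N -> (1 - alpha) * w (inord i) <= nth 0 l i
    <= (1 - alpha) * w (inord i) + delta.
  by move=> ik; have := hl i ik; rewrite nth_mkseq.
have lcube : in_cube k l.
  rewrite /in_cube lk eqxx/=; apply/(all_nthP 0) => i; rewrite lk => ik.
  by have := hnth i ik; have := wa0 (inord i); have := wa1 (inord i); lra.
(* This is the required inequality for the last coordinate, which is 1 minus this sum: the box
   raises the sum by at most [k * delta <= alpha]. *)
have suml : \sum_(x <- l) x <= 1 - (1 - alpha) * w ord_max.
  have -> : 1 - (1 - alpha) * w ord_max =
      (1 - alpha) * (\sum_(i < k) w (inord i)) + alpha.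
    have -> : \sum_(i < k) w (inord i) = 1 - w ord_max.
      rewrite -w1 big_ord_recr/= addrK; apply: eq_bigr => i _; congr w.
      by apply/val_inj; rewrite /= inordK// ltnS ltnW.
    ring.
  apply: (@le_trans _ _ (\sum_(i < k) ((1 - alpha) * w (inord i) + delta))).
    rewrite (sum_seq_nth lk); apply: ler_sum => i _.
    by have /andP[] := hnth i (ltn_ord i).
  by rewrite big_split/= -mulr_sumr sumr_const card_ord -mulr_natl lerD2l.
have suml1 : \sum_(x <- l) x <= 1 by have := wa0 ord_max; lra.
rewrite /simplex_ext lcube suml1/=.
apply: cf => [|j]; first exact: simplex_point_in_simplex.
rewrite /simplex_point /=; case: ltnP => jk.
  by have /andP[+ _] := hnth j jk; rewrite inord_val.
have -> : j = ord_max by apply/val_inj/eqP; rewrite /= eqn_leq jk -ltnS ltn_ord.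
by move: suml; lra.
Qed.

End simplex_integral.

(** * Wealth of the universal portfolio as an average of wealths *)

Section strategies.
Context {R : realType}.
Variables (m k : nat).
Implicit Types (S : @param_strategy R m k.+1) (x : nat -> 'I_m -> R).

Lemma wealthS (P : nat -> 'I_m -> R) x n :
  wealth P x n.+1 = wealth P x n * dotv (P n) (x n).
Proof. by rewrite /wealth big_ord_recr. Qed.

Definition borel_strategy S := forall t i, borel_fun (fun w => S t w i).

Definition unit_strategy S := forall t w i, in_simplex w -> 0 <= S t w i <= 1.

Lemma borel_wealth S x n : borel_strategy S ->
  borel_fun (fun w => wealth (fun s => S s w) x n).
Proof.
move=> mS d T w mw; apply: measurable_prod => t _.
apply: measurable_sum => i; apply: measurable_funM => //.
exact: mS.
Qed.

(** Weights are at most 1, so a day's return is at most the sum of the asset returns. This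
    market-dependent bound only secures integrability and never enters the regret. *)
Lemma wealth_bounded S x n : unit_strategy S -> (forall t i, 0 <= x t i) ->
  simplex_bounded (fun w => wealth (fun s => S s w) x n)
    (\prod_(t < n) \sum_(i < m) x t i).
Proof.
move=> S01 x0 w ws.
have dot_ge0 t : 0 <= dotv (S t w) (x t).
  by apply: sumr_ge0 => i _; rewrite mulr_ge0//; have /andP[] := S01 t w i ws.
apply/andP; split; first exact: prodr_ge0.
apply: ler_prod => t _; rewrite dot_ge0/=; apply: ler_sum => i _.
by rewrite ler_piMl//; have /andP[] := S01 t w i ws.
Qed.

(* The integrals telescope: the wealth-weighted average of the one-day returns
   on day t is the ratio of the average wealths on days t + 1 and t. *)
Lemma wealth_univ_portfolio S x n : borel_strategy S -> unit_strategy S ->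
  (forall t i, 0 <= x t i) ->
  (forall t, 0 < simplex_int (fun w => wealth (fun s => S s w) x t)) ->
  wealth (univ_portfolio S x) x n =
  simplex_int (fun w => wealth (fun s => S s w) x n) /
  simplex_int (fun w => wealth (fun s => S s w) x 0).
Proof.
move=> mS S01 x0 I0; elim: n => [|n IH].
  by rewrite {1}/wealth big_ord0 divff// gt_eqF.
rewrite wealthS IH.
set B := \prod_(t < n) \sum_(i < m) x t i.
have B0 : 0 <= B by apply: prodr_ge0 => t _; exact: sumr_ge0.
have -> : dotv (univ_portfolio S x n) (x n) =
    simplex_int (fun w => wealth (fun s => S s w) x n.+1) /
    simplex_int (fun w => wealth (fun s => S s w) x n).
  rewrite [X in simplex_int X / _](_ : _ = fun w =>
    \sum_(i < m) x n i * (S n w i * wealth (fun s => S s w) x n)); last first.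
    apply/funext => w; rewrite wealthS /dotv mulr_sumr.
    by apply: eq_bigr => i _; ring.
  rewrite (simplex_int_sum _ _ B0) => [|i|i w ws].
  - rewrite /dotv mulr_suml; apply: eq_bigr => i _.
    by rewrite /univ_portfolio; ring.
  - move=> d T w mw; apply: measurable_funM; first exact: mS.
    exact: borel_wealth.
  - have /andP[W0 WB] := wealth_bounded n S01 x0 ws.
    have /andP[s0 s1] := S01 n w i ws.
    by rewrite mulr_ge0//= (le_trans _ WB)// ler_piMl.
by rewrite mulrC mulrA divfK// gt_eqF.
Qed.

End strategies.

(** * Cost of the [eps]-modification *)

Section eps_modification.
Context {R : realType}.
Variables (m k : nat) (eps : R).
Hypotheses (m0 : (0 < m)%N) (eps01 : 0 < eps < 1).
Implicit Types (S : @param_strategy R m k.+1).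

(** The bound is chosen so that the retained share is at least [(t + 1) / (t + 2)], whose product
    over [n] days telescopes to [1 / (n + 1)]. *)
Lemma eps_mod_coef t :
  0 <= eps / (2 * (t%:R + 1) ^+ 2) <= t.+2%:R^-1.
Proof.
have /andP[e0 e1] := eps01.
have p : 0 < 2 * (t%:R + 1 : R) ^+ 2 by rewrite mulr_gt0// exprn_gt0// ltr_wpDl.
apply/andP; split; first by rewrite divr_ge0// ltW.
rewrite ler_pdivrMr// ler_pdivlMl ?ltr0n//.
have t0 : 0 <= (t%:R : R) by [].
have -> : (t.+2%:R : R) = t%:R + 2 by rewrite -addn2 natrD.
by nra.
Qed.

Lemma borel_eps_mod S : borel_strategy S -> borel_strategy (eps_mod S eps).
Proof.
move=> mS t i d T w mw; apply: measurable_funD => //.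
by apply: measurable_funM => //; exact: mS.
Qed.

Lemma unit_eps_mod S : unit_strategy S -> unit_strategy (eps_mod S eps).
Proof.
move=> S01 t w i ws; have /andP[s0 s1] := S01 t w i ws.
have /andP[c0 c1] := eps_mod_coef t.
have c2 : eps / (2 * (t%:R + 1) ^+ 2) <= 1.
  by rewrite (le_trans c1)// invf_le1 ?ltr0n// ler1n.
(* This exhibits a convex combination of [S t w i] and [1 / m], both in [[0, 1]]. *)
have -> : eps_mod S eps t w i = (1 - eps / (2 * (t%:R + 1) ^+ 2)) * S t w i
    + eps / (2 * (t%:R + 1) ^+ 2) * m%:R^-1.
  by rewrite /eps_mod -[in RHS]mulrA -invfM mulrAC.
have mi : 0 <= (m%:R^-1 : R) <= 1.
  by rewrite invr_ge0 ler0n/= invf_le1 ?ltr0n// ler1n.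
move: c0 c1 c2 mi; move: (eps / _) => c; nra.
Qed.

Lemma eps_mod_ge S t w i : 0 <= S t w i ->
  t.+1%:R / t.+2%:R * S t w i <= eps_mod S eps t w i.
Proof.
move=> s0; have /andP[c0 c1] := eps_mod_coef t.
have /andP[e0 _] := eps01.
rewrite /eps_mod ler_wpDr//.
  by rewrite divr_ge0 ?(ltW e0)// !mulr_ge0// exprn_ge0// addr_ge0.
apply: ler_wpM2r => //.
have -> : t.+1%:R / t.+2%:R = 1 - t.+2%:R^-1 :> R.
  by apply/eqP; rewrite eq_sym subr_eq -[X in _ + X]mul1r -mulrDl natr1 divff.
by rewrite lerD2l lerN2.
Qed.

End eps_modification.

(** * Stability of indicator aggregation under a change of weights *)

Section indicator_aggregation.
Context {R : realType}.
Variables (m k : nat) (d : @IA_data R m k.+1).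
Hypothesis (dv : IA_valid d).

Let x_gt0 t i : 0 < d.1 t i. Proof. by case: dv. Qed.

Let v_gt0 t i j : 0 < d.2 t i j.
Proof. by case: dv => _ [/(_ t i j)/andP[]]. Qed.

Let v_le1 t i j : d.2 t i j <= 1.
Proof. by case: dv => _ [/(_ t i j)/andP[]]. Qed.

Definition IA_den t (w : 'I_k.+1 -> R) := \sum_(l < m) dotv w (d.2 t l).

Lemma IA_denE t w : IA_den t w = \sum_j w j * \sum_(l < m) d.2 t l j.
Proof.
rewrite /IA_den exchange_big/=; apply: eq_bigr => j _.
by rewrite mulr_sumr.
Qed.

(** Normalization supplies one asset with indicator 1, and no indicator exceeds 1. By [IA_denE]
    these sums are the coefficients of the denominator as a linear form in [w]. *)
Lemma sum_indicator_bounds t j : 1 <= \sum_(l < m) d.2 t l j <= m%:R.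
Proof.
apply/andP; split.
  have [i vi] : exists i, d.2 t i j = 1 by case: dv => _ [_ /(_ t j)].
  by rewrite (bigD1 i)//= vi lerDl sumr_ge0// => l _; exact: ltW.
rewrite -[m in _ <= m%:R](card_ord m) -sumr_const.
by apply: ler_sum => l _; exact: v_le1.
Qed.

Lemma IA_den_ge1 t w : in_simplex w -> 1 <= IA_den t w.
Proof.
move=> [w01 w1]; rewrite IA_denE -w1; apply: ler_sum => j _.
by rewrite ler_peMr//; [have /andP[] := w01 j|
  have /andP[] := sum_indicator_bounds t j].
Qed.

(** Indicators are positive, so a zero product would force every weight to vanish, against their sum
    being 1. *)
Lemma dotv_indicator_gt0 t w i : in_simplex w -> 0 < dotv w (d.2 t i).
Proof.
move=> [w01 w1].
have wv0 j : 0 <= w j * d.2 t i j.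
  by rewrite mulr_ge0 ?(ltW (v_gt0 _ _ _))//; have /andP[] := w01 j.
rewrite lt_neqAle sumr_ge0// andbT; apply/eqP => /esym/psumr_eq0P wv.
have : \sum_j w j = 0 :> R.
  apply: big1 => j _; have /eqP := wv (fun j _ => wv0 j) j isT.
  by rewrite mulf_eq0 (gt_eqF (v_gt0 t i j)) orbF => /eqP.
by move/eqP; rewrite w1 oner_eq0.
Qed.

Lemma IA_gt0 t w i : in_simplex w -> 0 < IA d.2 t w i.
Proof.
move=> ws; rewrite divr_gt0 ?dotv_indicator_gt0//.
exact: lt_le_trans (IA_den_ge1 t ws).
Qed.

Lemma borel_IA : borel_strategy (IA d.2).
Proof.
have mdot t i : borel_fun (fun w : 'I_k.+1 -> R => dotv w (d.2 t i)).
  move=> d' T w mw; apply: measurable_sum => j.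
  exact: measurable_funM.
move=> t i d' T w mw; apply: measurable_funM; first exact: mdot.
apply: (measurableT_comp (@measurable_invr R)).
by apply: measurable_sum => l; exact: mdot.
Qed.

Lemma unit_IA : unit_strategy (IA d.2).
Proof.
move=> t w i ws; rewrite ltW ?IA_gt0//=.
have den0 : 0 < IA_den t w by exact: lt_le_trans (IA_den_ge1 t ws).
rewrite ler_pdivrMr// mul1r (bigD1 i)//= lerDl sumr_ge0// => l _.
exact/ltW/dotv_indicator_gt0.
Qed.

(* Moving from [w] to [w'] multiplies each numerator by at least 1 - alpha,
   while the denominator, which is at least 1, grows by at most alpha * m. *)
Lemma IA_ge t w w' (alpha : R) i : 0 <= alpha <= 1 ->
  in_simplex w -> in_simplex w' -> (forall j, (1 - alpha) * w j <= w' j) ->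
  (1 - alpha) / (1 + alpha * m%:R) * IA d.2 t w i <= IA d.2 t w' i.
Proof.
move=> /andP[a0 a1] ws ws' ww'.
have num : (1 - alpha) * dotv w (d.2 t i) <= dotv w' (d.2 t i).
  rewrite mulr_sumr; apply: ler_sum => j _; rewrite mulrA.
  by rewrite ler_wpM2r// ltW.
have D1 := IA_den_ge1 t ws; have D'1 := IA_den_ge1 t ws'.
have am : 0 <= alpha * m%:R by rewrite mulr_ge0.
have den : IA_den t w' <= (1 + alpha * m%:R) * IA_den t w.
  (* The nonnegative differences [w' j - (1 - alpha) * w j] sum to [alpha], and each coefficient is
     at most [m]. *)
  have le1 : IA_den t w' - (1 - alpha) * IA_den t w <= alpha * m%:R.
    rewrite !IA_denE mulr_sumr -sumrB.
    have -> : alpha * m%:R = \sum_j (w' j - (1 - alpha) * w j) * m%:R.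
      case: ws ws' => [_ w1] [_ w'1].
      by rewrite -mulr_suml sumrB -mulr_sumr w1 w'1; ring.
    apply: ler_sum => j _; rewrite mulrA -mulrBl ler_wpM2l ?subr_ge0//.
    by have /andP[] := sum_indicator_bounds t j.
  by nra.
rewrite /IA -/(IA_den t w) -/(IA_den t w') mulrACA -invfM.
have P : 0 < dotv w (d.2 t i) by exact: dotv_indicator_gt0.
rewrite ler_pdivrMr; last by nra.
rewrite mulrAC ler_pdivlMr; last by lra.
apply: ler_pM => //; first by rewrite mulr_ge0 ?subr_ge0 ?(ltW P).
lra.
Qed.

Lemma wealth_IA_gt0 w n : in_simplex w -> (0 < m)%N ->
  0 < wealth (fun t => IA d.2 t w) d.1 n.
Proof.
move=> ws m0; apply: prodr_gt0 => t _.
rewrite /dotv (bigD1 (Ordinal m0))//=.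
apply: ltr_wpDr; last by rewrite mulr_gt0// IA_gt0.
by apply: sumr_ge0 => i _; rewrite mulr_ge0// ltW// IA_gt0.
Qed.

Section universal.
Variable eps : R.
Hypotheses (m0 : (0 < m)%N) (eps01 : 0 < eps < 1).

Let S := eps_mod (IA d.2) eps.

(** Each day costs one factor from moving the weights ([IA_ge]) and one from the modification
    ([eps_mod_ge]); the latter telescope. *)
Lemma wealth_eps_mod_IA_ge w w' (alpha : R) n : 0 <= alpha <= 1 ->
  in_simplex w -> in_simplex w' -> (forall j, (1 - alpha) * w j <= w' j) ->
  n.+1%:R^-1 * ((1 - alpha) / (1 + alpha * m%:R)) ^+ n *
    wealth (fun t => IA d.2 t w) d.1 n <= wealth (fun t => S t w') d.1 n.
Proof.
move=> a01 ws ws' ww'; set b := (_ / _).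
have b0 : 0 <= b.
  case/andP: a01 => a0 a1; rewrite divr_ge0 ?subr_ge0//.
  by rewrite addr_ge0// mulr_ge0.
elim: n => [|n IH]; first by rewrite /wealth !big_ord0 expr0 invr1 !mulr1.
rewrite !wealthS.
have -> : n.+2%:R^-1 * b ^+ n.+1 *
    (wealth (fun t => IA d.2 t w) d.1 n * dotv (IA d.2 n w) (d.1 n)) =
    (n.+1%:R^-1 * b ^+ n * wealth (fun t => IA d.2 t w) d.1 n) *
    (n.+1%:R / n.+2%:R * (b * dotv (IA d.2 n w) (d.1 n))).
  have : n.+1%:R^-1 * n.+1%:R = 1 :> R by rewrite mulVf.
  rewrite exprS; move: (n.+1%:R) (n.+1%:R^-1) (n.+2%:R^-1) => p q r pq.
  by rewrite -[LHS]mul1r -{1}pq; ring.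
have dot0 : 0 <= dotv (IA d.2 n w) (d.1 n).
  by apply: sumr_ge0 => i _; rewrite mulr_ge0// ltW// IA_gt0.
apply: ler_pM => //.
- by rewrite !mulr_ge0// ?invr_ge0// ?exprn_ge0// ltW// wealth_IA_gt0.
- by apply: mulr_ge0; [rewrite divr_ge0|exact: mulr_ge0].
rewrite mulrA /dotv mulr_sumr; apply: ler_sum => i _.
rewrite mulrA ler_wpM2r ?(ltW (x_gt0 _ _))//.
apply: le_trans (eps_mod_ge eps01 (ltW (IA_gt0 _ _ ws'))).
rewrite -mulrA ler_wpM2l ?divr_ge0//.
exact: IA_ge.
Qed.

Lemma wealth_univ_IA_ge w (alpha : R) n : 0 < alpha < 1 -> in_simplex w ->
  n.+1%:R^-1 * ((1 - alpha) / (1 + alpha * m%:R)) ^+ n *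
    (alpha / k.+1%:R) ^+ k * wealth (fun t => IA d.2 t w) d.1 n <=
  wealth (univ_portfolio S d.1) d.1 n.
Proof.
move=> /andP[a0 a1] ws.
have mS : borel_strategy S by exact/borel_eps_mod/borel_IA.
have S01 : unit_strategy S by apply: unit_eps_mod => //; exact: unit_IA.
have x0 t i : 0 <= d.1 t i by exact: ltW.
have B0 t : 0 <= \prod_(s < t) \sum_(i < m) d.1 s i.
  by apply: prodr_ge0 => s _; exact: sumr_ge0.
pose c t := t.+1%:R^-1 * ((1 - alpha) / (1 + alpha * m%:R)) ^+ t *
    wealth (fun t => IA d.2 t w) d.1 t.
have c0 t : 0 < c t.
  rewrite !mulr_gt0 ?invr_gt0// ?wealth_IA_gt0// exprn_gt0//.
  by rewrite divr_gt0 ?subr_gt0// ltr_wpDr// mulr_ge0// ltW.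
have I_ge t : k`!%:R * (c t * (alpha / k.+1%:R) ^+ k) <=
    simplex_int (fun w => wealth (fun s => S s w) d.1 t).
  apply: (simplex_int_ge (B0 t) (borel_wealth _ _ mS)
    (wealth_bounded _ S01 x0) (ltW (c0 t)) _ ws); first by rewrite !ltW.
  by move=> w' ws' ww'; apply: wealth_eps_mod_IA_ge => //; rewrite !ltW.
(* Positivity is needed on every day, since each of these integrals is a denominator in the
   telescoping. *)
have I_gt0 t : 0 < simplex_int (fun w => wealth (fun s => S s w) d.1 t).
  apply: lt_le_trans (I_ge t).
  apply: mulr_gt0; first by rewrite ltr0n fact_gt0.
  by apply: mulr_gt0 => //; rewrite exprn_gt0// divr_gt0.
rewrite wealth_univ_portfolio// ler_pdivlMr//.
apply: le_trans (I_ge n).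
(* Bounding the simplex by the cube suffices: this [k!] cancels the one in [I_ge], so the volume of
   the simplex is never computed. *)
have I0 : simplex_int (fun w => wealth (fun s => S s w) d.1 0) <= k`!%:R.
  rewrite -[leRHS]mulr1; apply: simplex_int_le => //.
    exact: borel_wealth.
  by move=> w' _; rewrite /wealth big_ord0 ler01 lexx.
rewrite [X in X * _ <= _]mulrAC -/(c n) [leLHS]mulrC ler_wpM2r//.
by apply: mulr_ge0; [exact: ltW|rewrite exprn_ge0// divr_ge0// ltW].
Qed.

End universal.
End indicator_aggregation.

(** * Logarithmic estimate of the regret and conclusion *)

Import numFieldNormedType.Exports.

Section regret.
Context {R : realType}.

(** Apply [ln y < y] to the square root of [n + 1], whose logarithm is half the wanted one; that
    root is at most twice the root of [n]. *)
Lemma ln_succ_le_sqrt n : (0 < n)%N ->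
  ln n.+1%:R <= 4 * Num.sqrt n%:R :> R.
Proof.
move=> n0; set s := Num.sqrt n%:R.
have s1 : 1 <= s by rewrite -sqrtr1 ler_sqrt ?ler1n// ltr0n.
have sn : s ^+ 2 = n%:R by rewrite sqr_sqrtr.
have -> : n.+1%:R = Num.sqrt n.+1%:R ^+ 2 :> R by rewrite sqr_sqrtr.
have q0 : 0 < Num.sqrt n.+1%:R :> R by rewrite sqrtr_gt0.
have q2 : Num.sqrt n.+1%:R <= 2 * s.
  have s0 : 0 <= 2 * s by lra.
  rewrite -(ger0_norm s0) -sqrtr_sqr ler_sqrt ?sqr_ge0//.
  by rewrite exprMn sn -natr1; nra.
rewrite lnXn// mulr2n.
by have := ltW (ln_sublinear q0); lra.
Qed.

Lemma cvg_sqrt_inv : Num.sqrt (n%:R^-1 : R) @[n --> \oo] --> (0 : R).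
Proof.
rewrite -(@sqrtr0 R); apply: continuous_cvg; first exact: sqrt_continuous.
(* The harmonic sequence is [1 / (n + 1)], hence the shift. *)
by rewrite -cvg_shiftS; exact: cvg_harmonic.
Qed.

(** In the constant, [4 * k.+1] collects the [k + 1] factors [1 / (n + 1)], [m.+1] comes from the
    [n]-th power, and [k * k.+1] from the [k] divisions by [k.+1]. *)
Lemma regret_factor_ge m k n : (0 < n)%N ->
  - ((4 * k.+1%:R + m.+1%:R + k%:R * k.+1%:R) * Num.sqrt n%:R) <=
  ln (n.+1%:R^-1 * ((1 - n.+1%:R^-1) / (1 + n.+1%:R^-1 * m%:R)) ^+ n *
      (n.+1%:R^-1 / k.+1%:R) ^+ k) :> R.
Proof.
move=> n0; set s := Num.sqrt n%:R.
have s1 : 1 <= s by rewrite -sqrtr1 ler_sqrt ?ler1n// ltr0n.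
have nR0 : 0 < n%:R :> R by rewrite ltr0n.
have -> : (1 - n.+1%:R^-1) / (1 + n.+1%:R^-1 * m%:R) =
    (1 + m.+1%:R / n%:R)^-1 :> R.
  have mR : 0 <= (m%:R : R) by [].
  rewrite -!natr1; field; apply/and3P; split; lra.
have p : 0 < 1 + m.+1%:R / n%:R :> R by rewrite ltr_wpDr// divr_ge0.
rewrite !lnM ?posrE ?invr_gt0 ?exprn_gt0 ?mulr_gt0 ?invr_gt0 ?exprn_gt0//.
rewrite !lnXn ?mulr_gt0 ?invr_gt0// lnM ?posrE ?invr_gt0// !lnV ?posrE//.
rewrite -[(- _) *+ n]mulr_natl -[(_ + _) *+ k]mulr_natl.
have l1 : ln n.+1%:R <= 4 * s by exact: ln_succ_le_sqrt.
(* By [ln (1 + y) <= y], the [n] daily losses together cost at most [m + 1], uniformly in [n]. *)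
have l2 : n%:R * ln (1 + m.+1%:R / n%:R) <= m.+1%:R * s :> R.
  apply: (@le_trans _ _ m.+1%:R); last by rewrite ler_peMr.
  rewrite -ler_pdivlMl// [leRHS]mulrC; apply: le_ln1Dx.
  by apply: (@lt_le_trans _ _ 0); [rewrite ltrN10|exact: divr_ge0].
have l3 : ln k.+1%:R <= k.+1%:R * s :> R.
  by rewrite (le_trans (ltW (ln_sublinear _)))// ler_peMr.
have kR : 0 <= (k%:R : R) by [].
have l4 : k%:R * ln n.+1%:R <= k%:R * (4 * s) by rewrite ler_wpM2l.
have l5 : k%:R * ln k.+1%:R <= k%:R * (k.+1%:R * s) by rewrite ler_wpM2l.
move: l5 l4 l2 l1; rewrite -[k.+1%:R]natr1.
move: (ln _) (ln _) (ln (1 + _)) => a b c; lra.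
Qed.

End regret.

Theorem mainTheorem9 (R : realType) (m k : nat) :
  (2 <= m)%N -> (2 <= k)%N ->
  universalizable (@IA_valid R m k) (fun d => d.1) (fun d => IA d.2).
Proof.
move=> m2; case: k => [//|k] _ eps eps01.
have m0 : (0 < m)%N by exact: ltnW.
pose C : R := 4 * k.+1%:R + m.+1%:R + k%:R * k.+1%:R.
(* This is the bound of [regret_factor_ge] spread over [n] days; [C] depends only on [m] and [k]. *)
exists (fun n => C * Num.sqrt n%:R^-1); split.
  by rewrite -[X in _ --> X](mulr0 C); apply: cvgMr; exact: cvg_sqrt_inv.
move=> d dv n n0 w ws.
have nR0 : 0 < n%:R :> R by rewrite ltr0n.
(* The choice [alpha = 1 / (n + 1)] stays strictly below 1 even for [n = 1], which keeps [K]
   positive. *)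
have a01 : 0 < (n.+1%:R^-1 : R) < 1.
  by rewrite invr_gt0 ltr0n/= invf_lt1 ?ltr0n// ltr1n.
have := wealth_univ_IA_ge dv m0 eps01 n a01 ws.
have := @regret_factor_ge R m k n n0.
set K := (_ * _ ^+ n * _ ^+ k).
have K0 : 0 < K.
  have a0 : 0 < n.+1%:R^-1 :> R by rewrite invr_gt0 ltr0n.
  apply: mulr_gt0; last by rewrite exprn_gt0// divr_gt0.
  apply: mulr_gt0 => //; rewrite exprn_gt0// divr_gt0//.
  by rewrite subr_gt0; case/andP: a01.
have W0 := wealth_IA_gt0 dv n ws m0.
rewrite -/C => lnK KU.
have U0 : 0 < wealth (univ_portfolio (eps_mod (IA d.2) eps) d.1) d.1 n.
  by apply: lt_le_trans KU; exact: mulr_gt0.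
have lnU : ln K + ln (wealth (fun t => IA d.2 t w) d.1 n) <=
    ln (wealth (univ_portfolio (eps_mod (IA d.2) eps) d.1) d.1 n).
  by rewrite -lnM ?posrE// ler_ln ?posrE//; exact: mulr_gt0.
have -> : C * Num.sqrt n%:R^-1 = n%:R^-1 * (C * Num.sqrt n%:R).
  rewrite sqrtrV// mulrCA; congr (_ * _).
  rewrite -{2}(sqr_sqrtr (ltW nR0)) expr2 invfM -mulrA mulVf ?mulr1//.
  by rewrite sqrtr_eq0 -ltNge.
rewrite /logret -mulrBr ler_wpM2l ?invr_ge0//.
by move: lnU lnK; lra.
Qed.
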